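(* Let $\Omega\subset\mathbb{R}^2$ be a polygonal region with boundary $\partial\Omega$ and let $X$ be a variable radius maximal Poisson-disk sampling on $\Omega$ containing all vertices of $\Omega$, with inhibition radius $r(\mathbf{x},\mathbf{y})=\min(\rho(\mathbf{x}),\rho(\mathbf{y}))$, where $\rho:\mathbb{R}^2\to\mathbb{R}$ is a positive Lipschitz continuous function with Lipschitz constant $L$. Furthermore, let the coverage radius $R^{\delta}$ of $X\cap\partial\Omega$ along the boundary fulfill $R^{\delta}(\mathbf{x},\mathbf{y})<\frac{r(\mathbf{x},\mathbf{y})}{\sqrt{2}(1+L)}$, i.e., $$|\mathbf{x}-\mathbf{y}|<\frac{\sqrt{2}}{1+L}\,r(\mathbf{x},\mathbf{y})$$ for all pairs $\mathbf{x},\mathbf{y}\in\partial\Omega\cap X$ that are consecutive along the boundary. Then the circumcenters of all triangles in the Delaunay triangulation of $X$ are contained in the closure $\overline{\Omega}$.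
   Context: A variable radius maximal Poisson-disk sampling on a domain $\Omega\subset\mathbb{R}^d$ with inhibition radius $r(\cdot,\cdot)$ and coverage radius $R(\cdot,\cdot)$ (positive functions of pairs of points of $\Omega$) is a finite set of points $X=\{\mathbf{x}_i\}_{i=1}^n\subset\Omega$ satisfying: (1) empty disk property: $|\mathbf{x}_i-\mathbf{x}_j|>r(\mathbf{x}_i,\mathbf{x}_j)$ for all $i\ne j$; (2) maximality: for every $\mathbf{y}\in\Omega$ there is some $\mathbf{x}_i\in X$ with $|\mathbf{y}-\mathbf{x}_i|<R(\mathbf{y},\mathbf{x}_i)$. Here $\Omega$ is understood to include its boundary points that belong to $X$ (in particular its vertices). No probabilistic property of the sampling is used. $|\cdot|$ is the Euclidean norm. Two points $\mathbf{x},\mathbf{y}\in X\cap\partial\Omega$ are consecutive along the boundary if they lie on a common edge of the polygon $\Omega$ and no other point of $X$ lies on the segment between them. The hypothesis on the boundary coverage radius $R^\delta$ means exactly the displayed spacing condition on consecutive points. The Delaunay triangulation of $X$ is a triangulation with vertex set $X$ in which the open circumscribed disk of each triangle contains no point of $X$.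
   Formalization: The Delaunay triangulation of X is taken to be one that covers exactly the closure of Ω; for nonconvex Ω, Delaunay triangles of the convex hull of X lying outside Ω are excluded, since the claim fails for them (e.g. an equilateral notch in a square). *)

(* Defs.v *)
From HB Require Import structures.
From mathcomp Require Import all_boot all_order all_algebra finmap.
From mathcomp Require Import all_classical all_reals all_analysis.
Set Implicit Arguments.
Unset Strict Implicit.
Unset Printing Implicit Defensive.
Import Order.TTheory GRing.Theory Num.Theory.
Import numFieldNormedType.Exports.
Local Open Scope classical_set_scope.
Local Open Scope ring_scope.

(* The library norm on 'rV[R]_d is the sup norm.  It induces the same topology
   and the same bounded sets as the Euclidean norm, so [closure], [interior],
   [connected] and [bounded_set] below are the usual ones, but distances and
   Lipschitz constants must be taken with respect to [l2dist]. *)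
Definition l2norm (R : realType) (d : nat) (u : 'rV[R]_d) : R :=
  Num.sqrt (\sum_(i < d) u 0 i ^+ 2).

Definition l2dist (R : realType) (d : nat) (x y : 'rV[R]_d) : R := l2norm (x - y).

Definition l2lipschitz (R : realType) (d : nat) (L : R) (f : 'rV[R]_d -> R) :=
  forall x y, `|f x - f y| <= L * l2dist x y.

Definition frontier (T : topologicalType) (A : set T) : set T :=
  closure A `\` interior A.

Definition hull (R : realType) (d : nat) (A : set 'rV[R]_d) : set 'rV[R]_d :=
  smallest (@convex_set R 'rV[R]_d) A.

(* Segments and triangles are encoded by their finite sets of vertices. *)
Definition carrier (R : realType) (d : nat) (K : {fset {fset 'rV[R]_d}}) :
    set 'rV[R]_d :=
  \bigcup_(A in [set` K]) hull [set` A].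

Definition vertices (R : realType) (d : nat) (K : {fset {fset 'rV[R]_d}}) :
    set 'rV[R]_d :=
  \bigcup_(A in [set` K]) [set` A].

Definition face_to_face (R : realType) (d : nat) (K : {fset {fset 'rV[R]_d}}) :=
  forall A B, A \in K -> B \in K ->
    hull [set` A] `&` hull [set` B] = hull ([set` A] `&` [set` B]).

(* [E] is the set of edges of the polygonal region [Omega], each edge being given
   by its two endpoints.  [Omega] need not be simply connected, and it may contain
   an arbitrary part of its frontier. *)
Record polygonal_region (R : realType) (Omega : set 'rV[R]_2)
    (E : {fset {fset 'rV[R]_2}}) : Prop := PolygonalRegion {
  pr_bounded : bounded_set Omega ;
  pr_nonempty : interior Omega !=set0 ;
  pr_connected : connected (interior Omega) ;
  pr_closure : Omega `<=` closure (interior Omega) ;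
  pr_edges : forall e, e \in E -> #|` e|%fset = 2%N ;
  pr_face_to_face : face_to_face E ;
  pr_frontier : frontier Omega = carrier E }.

Record maximal_poisson_disk_sampling (R : realType) (d : nat)
    (Omega : set 'rV[R]_d) (r Rc : 'rV[R]_d -> 'rV[R]_d -> R)
    (X : set 'rV[R]_d) : Prop := MaximalPoissonDiskSampling {
  pds_inhibition_gt0 : forall x y, Omega x -> Omega y -> 0 < r x y ;
  pds_coverage_gt0 : forall x y, Omega x -> Omega y -> 0 < Rc x y ;
  pds_finite : finite_set X ;
  pds_sub : X `<=` Omega ;
  pds_empty_disk : forall x y, X x -> X y -> x <> y -> r x y < l2dist x y ;
  pds_maximal : forall y, Omega y -> exists2 x, X x & l2dist y x < Rc y x }.

Definition boundary_consecutive (R : realType) (Omega : set 'rV[R]_2)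
    (E : {fset {fset 'rV[R]_2}}) (X : set 'rV[R]_2) (x y : 'rV[R]_2) : Prop :=
  [/\ (X `&` frontier Omega) x, (X `&` frontier Omega) y, x <> y,
      exists2 e, e \in E & hull [set` e] x /\ hull [set` e] y &
      forall z, X z -> hull [set x; y] z -> z = x \/ z = y].

Definition collinear (R : realType) (d : nat) (A : set 'rV[R]_d) : Prop :=
  exists a u : 'rV[R]_d, forall v, A v -> exists t : R, v = a + t *: u.

Definition triangle (R : realType) (d : nat) (A : {fset 'rV[R]_d}) : Prop :=
  #|` A|%fset = 3%N /\ ~ collinear [set` A].

Record triangulation (R : realType) (D X : set 'rV[R]_2)
    (T : {fset {fset 'rV[R]_2}}) : Prop := Triangulation {
  tri_triangle : forall A, A \in T -> triangle A ;
  tri_face_to_face : face_to_face T ;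
  tri_vertices : vertices T = X ;
  tri_carrier : carrier T = D }.

Definition circumscribed (R : realType) (A : {fset 'rV[R]_2}) (c : 'rV[R]_2)
    (s : R) : Prop :=
  forall v, v \in A -> l2dist c v = s.

Definition circumcenter (R : realType) (A : {fset 'rV[R]_2}) (c : 'rV[R]_2) :
    Prop :=
  exists s, circumscribed A c s.

(* Since [Omega] need not be convex, what is triangulated is the closure of [Omega]
   and not the convex hull of [X]; for convex [Omega] with vertices in [X] the two
   sets coincide. *)
Definition delaunay_triangulation (R : realType) (Omega X : set 'rV[R]_2)
    (T : {fset {fset 'rV[R]_2}}) : Prop :=
  triangulation (closure Omega) X T /\
  forall A c s, A \in T -> circumscribed A c s ->
    forall x, X x -> ~ (l2dist c x < s).

(* Main.v *)
Require Import Defs.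
From HB Require Import structures.
From mathcomp Require Import all_boot all_order all_algebra finmap.
From mathcomp Require Import all_classical all_reals all_analysis.
From mathcomp Require Import ring lra.
Set Implicit Arguments.
Unset Strict Implicit.
Unset Printing Implicit Defensive.
Import Order.TTheory GRing.Theory Num.Theory.
Import numFieldNormedType.Exports.
Local Open Scope classical_set_scope.
Local Open Scope ring_scope.

(** Suppose that the circumcenter [c] of a Delaunay triangle is outside
    [closure Omega].  The segment from the centroid [a] of the triangle to [c]
    starts in [closure Omega] and ends outside it, so it meets the frontier of
    [Omega] at some point [p] ([connected_meets_frontier]).  Since [a] lies in the
    open circumscribed disk ([centroid_in_disk]), so does [p], while no sample
    does.  Hence [p] lies on a boundary edge strictly between two consecutive
    samples [x] and [y] ([innermost_segment]), both outside the open disk, and the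
    line [x y] cuts the disk along a chord contained in the segment [x y].

    The center [c] is not on this line, otherwise it would be the midpoint of the
    chord, hence a frontier point ([center_on_chord_line]).  As [p] is on the
    line and on the segment from [a] to [c], some vertex [v] of the triangle is strictly
    across the line from [c] ([opposite_vertex]).  It lies in the cap cut off by the chord on the side
    away from the center, so the angle [x v y] is obtuse ([obtuse_across_chord]):
      [dist2 v x + dist2 v y < dist2 x y].
    On the other hand, the empty disk property at [v] and the Lipschitz condition
    give [rho x < (1 + L) * l2dist v x], and the same with [y]; together with the
    spacing condition on [x] and [y] this makes both [dist2 v x] and [dist2 v y]
    larger than half of [dist2 x y] ([far_from_short_edge]), a contradiction. *)

(** * Crossing the frontier, and finite sets *)

(** If [A] missed the frontier, its trace on [closure O] would equal its trace on
    [interior O], hence be both closed and open in [A]. *)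
Lemma connected_meets_frontier (T : topologicalType) (A O : set T) (a c : T) :
  connected A -> A a -> A c -> closure O a -> ~ closure O c ->
  exists2 p, A p & frontier O p.
Proof.
move=> cA Aa Ac Oa Oc; apply: contrapT => nop.
have AO : A `&` closure O = A `&` interior O.
  apply/seteqP; split=> p [Ap Op]; split=> //.
    by apply: contrapT => nOp; apply: nop; exists p.
  exact: (subset_closure (interior_subset Op)).
apply: Oc; suff : (A `&` closure O) c by case.
rewrite (cA (A `&` closure O))//; first by exists a.
- by exists (interior O) => //; exact: open_interior.
- by exists (closure O) => //; exact: closed_closure.
Qed.

Lemma finite_set_argmin (R : realType) (T : choiceType) (A : set T) (f : T -> R) :
  finite_set A -> A !=set0 -> exists2 a, A a & forall b, A b -> f a <= f b.
Proof.
move=> /finite_seqP[s ->] {A}.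
elim: s => [[a]//|x s IH _].
have [/IH[a sa mina]|s0] := pselect ([set` s] !=set0).
  have [ax|xa] := leP (f a) (f x).
    exists a; first by rewrite /= inE; apply/orP; right.
    by move=> b /=; rewrite inE => /predU1P[->//|/mina].
  exists x; first by rewrite /= inE eqxx.
  move=> b /=; rewrite inE => /predU1P[->//|/mina]; apply: le_trans; exact: ltW.
exists x; first by rewrite /= inE eqxx.
move=> b /=; rewrite inE => /predU1P[->//|sb].
by exfalso; apply: s0; exists b.
Qed.

Lemma fset_card2E (K : choiceType) (e : {fset K}) : #|` e|%fset = 2%N ->
  exists u w, e = [fset u; w]%fset.
Proof.
have : forall z, (z \in e) = (z \in enum_fset e) by [].
case: (enum_fset e) => [|u [|w [|]]] //= eE _; exists u, w.
by apply/fsetP => z; rewrite eE !inE.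
Qed.

Lemma fset_card3E (K : choiceType) (A : {fset K}) : #|` A|%fset = 3%N ->
  exists v1 v2 v3, v1 <> v2 /\ A = [fset v1; v2; v3]%fset.
Proof.
have : forall z, (z \in A) = (z \in enum_fset A) by [].
case: (enum_fset A) (fset_uniq A) => [|u [|w [|z [|]]]] //= /andP[+ _] AE _.
rewrite !inE negb_or => /andP[/eqP uw _]; exists u, w, z; split => //.
by apply/fsetP => k; rewrite AE !inE orbA.
Qed.

(** * Segments *)

Section Segments.
Variables (R : realType) (d : nat).
Implicit Types (x y z p : 'rV[R]_d) (A : set 'rV[R]_d) (t : R).

Lemma sub_hull A : A `<=` hull A.
Proof. exact: sub_gen_smallest. Qed.

Lemma hull_convex A x y t :
  hull A x -> hull A y -> 0 <= t <= 1 -> hull A (x + t *: (y - x)).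
Proof.
move=> hx hy /andP[t0 t1] M [cM AM].
have Mx : M x by exact: hx.
have My : M y by exact: hy.
have t01 : 0 <= t <= 1 by rewrite t0.
have := cM y x (Itv01 t0 t1); rewrite !inE => /(_ My Mx).
congr (M _); apply/rowP => i; rewrite /conv /= /unstable.onem !mxE.
by ring.
Qed.

Definition segment x y : set 'rV[R]_d :=
  [set x + t *: (y - x) | t in `[0, 1]].

(** This converts hulls of two points, in which polygonal edges and consecutive
    samples are expressed, into parametrized segments. *)
Lemma hull2E x y : hull [set x; y] = segment x y.
Proof.
apply/seteqP; split; last first.
  move=> _ [t /= t01 <-]; apply: hull_convex; last by rewrite in_itv in t01.
  - by apply: sub_hull; left.
  - by apply: sub_hull; right.
apply: smallest_sub.
  move=> a b l; rewrite !inE => -[s /= s01 <-] [t /= t01 <-].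
  have l0 : 0 <= l%:num by exact: ge0.
  have l1 : l%:num <= 1 by exact: le1.
  move: s01 t01; rewrite !in_itv /= => /andP[s0 s1] /andP[t0 t1].
  exists (l%:num * s + (1 - l%:num) * t).
    by rewrite /= in_itv /=; apply/andP; split; nra.
  apply/rowP => i; rewrite /conv/= /unstable.onem !mxE; ring.
move=> z [->|->].
  by exists 0; rewrite /= ?in_itv/= ?lexx ?ler01// scale0r addr0.
by exists 1; rewrite /= ?in_itv/= ?lexx ?ler01// scale1r addrC subrK.
Qed.

Lemma segmentC x y : segment x y = segment y x.
Proof. by rewrite -!hull2E setUC. Qed.

(** Comparing the parameters of [z] and [p] decides the alternative; the second
    one is the first read from the other endpoint. *)
Lemma segment_split x y z p : segment x y z -> segment x y p ->
  segment x z p \/ segment z y p.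
Proof.
have key a b t s : 0 <= s <= t -> segment a (a + t *: (b - a)) (a + s *: (b - a)).
  move=> /andP[s0 st]; have t0 := le_trans s0 st.
  have kt : s / t * t = s.
    have [t00|tn0] := eqVneq t 0; last by rewrite divfK.
    by apply: le_anti; rewrite t00 mulr0 s0 -{1}t00 st.
  exists (s / t); last by rewrite addrAC subrr add0r scalerA kt.
  rewrite /= in_itv /= divr_ge0//=.
  have [->|tn0] := eqVneq t 0; first by rewrite invr0 mulr0 ler01.
  by rewrite ler_pdivrMr ?mul1r// lt_neqAle eq_sym tn0.
move=> [t /= + <-] [s /= + <-]; rewrite !in_itv /= => /andP[t0 t1] /andP[s0 s1].
have [st|/ltW ts] := leP s t; [left|right]; first by apply: key; rewrite s0.
have flip k : x + k *: (y - x) = y + (1 - k) *: (x - y).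
  by apply/rowP => i; rewrite !mxE; ring.
rewrite segmentC !flip; apply: key; lra.
Qed.

Lemma segment_trans x y a b : segment x y a -> segment x y b ->
  segment a b `<=` segment x y.
Proof.
rewrite -!hull2E => xa xb; rewrite hull2E => _ [t /= t01 <-].
by apply: hull_convex; rewrite in_itv in t01.
Qed.

(** On a fixed line the sup norm is proportional to the Euclidean norm, so it can
    serve to select a shortest segment on an edge. *)
Lemma segment_norm_lt x y z : segment x y z -> z <> y -> `|z - x| < `|y - x|.
Proof.
move=> [t /= + <-]; rewrite in_itv /= => /andP[t0 t1] ty.
rewrite addrAC subrr add0r normrZ ger0_norm// gtr_pMl; last first.
  rewrite normr_gt0 subr_eq0; apply/eqP => yx; apply: ty.
  by rewrite yx subrr scaler0 addr0.
rewrite lt_neqAle t1 andbT; apply/eqP => t11; apply: ty.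
by rewrite t11 scale1r addrC subrK.
Qed.

Lemma connected_segment x y : connected (segment x y).
Proof.
apply: connected_continuous_connected; first exact: segment_connected.
apply: continuous_subspaceT => t.
by apply: cvgD; [exact: cvg_cst|apply: cvgZr_tmp; exact: cvg_id].
Qed.

(** Among the pairs of points of [X] on the edge whose segment contains [p], a
    pair of minimal length is consecutive: a point of [X] strictly in between
    would give a shorter segment that still contains [p]. *)
Lemma innermost_segment (X : set 'rV[R]_d) u w p :
  finite_set X -> X u -> X w -> segment u w p ->
  exists x y, [/\ X x, X y, segment u w x, segment u w y &
    segment x y p /\ forall z, X z -> segment x y z -> z = x \/ z = y].
Proof.
move=> fX Xu Xw uwp.
have su a b : segment a b a by rewrite -hull2E; apply: sub_hull; left.
have sw a b : segment a b b by rewrite -hull2E; apply: sub_hull; right.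
pose S := [set q : 'rV[R]_d * 'rV[R]_d | [/\ X q.1, X q.2, segment u w q.1,
  segment u w q.2 & segment q.1 q.2 p]].
have fS : finite_set S.
  by apply: (@sub_finite_set _ _ (X `*` X)); [case=> a b [] | exact: finite_setX].
have [|[x y] [/= Xx Xy ux uy xyp] min] :=
  finite_set_argmin (fun q => `|q.2 - q.1|) fS; first by exists (u, w).
exists x, y; split=> //; split=> // z Xz xyz.
apply: contrapT => /not_orP[zx zy].
have uz := segment_trans ux uy xyz.
have [xzp|zyp] := segment_split xyz xyp.
  by have := min (x, z) (And5 Xx Xz ux uz xzp); rewrite /= leNgt segment_norm_lt.
have := min (z, y) (And5 Xz Xy uz uy zyp).
rewrite /= leNgt distrC [ltRHS]distrC segment_norm_lt//.
by rewrite segmentC.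
Qed.
End Segments.

(** * Plane geometry of a chord and its cap *)

Section Coordinates.
Variable R : realType.
Implicit Types a c p v x y z : 'rV[R]_2.

Definition dist2 x y : R := (x 0 0 - y 0 0) ^+ 2 + (x 0 1 - y 0 1) ^+ 2.

Lemma l2distE x y : l2dist x y = Num.sqrt (dist2 x y).
Proof.
rewrite /l2dist /l2norm big_ord_recl big_ord1 !mxE /dist2.
by congr (Num.sqrt ((_ - _) ^+ 2 + (x 0 _ - y 0 _) ^+ 2)); apply/val_inj.
Qed.

Lemma dist2_ge0 x y : 0 <= dist2 x y.
Proof. by rewrite addr_ge0 ?sqr_ge0. Qed.

Lemma dist2C x y : dist2 x y = dist2 y x.
Proof. by rewrite /dist2; ring. Qed.

Lemma sqr_l2dist x y : l2dist x y ^+ 2 = dist2 x y.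
Proof. by rewrite l2distE sqr_sqrtr ?dist2_ge0. Qed.

Lemma l2dist_ge0 x y : 0 <= l2dist x y.
Proof. by rewrite l2distE sqrtr_ge0. Qed.

Lemma row2P x y : x 0 0 = y 0 0 -> x 0 1 = y 0 1 -> x = y.
Proof.
move=> h0 h1; apply/rowP => i; case: i => -[|[|//]] lti.
- by rewrite (_ : Ordinal lti = 0)//; apply/val_inj.
- by rewrite (_ : Ordinal lti = 1)//; apply/val_inj.
Qed.

Lemma dist2_gt0 x y : x <> y -> 0 < dist2 x y.
Proof.
move=> xy; rewrite lt_neqAle dist2_ge0 andbT eq_sym; apply/eqP => d0; apply: xy.
move: d0 => /eqP; rewrite paddr_eq0 ?sqr_ge0// !sqrf_eq0 !subr_eq0.
by move=> /andP[/eqP h0 /eqP h1]; exact: row2P.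
Qed.

(** [along x y] and [across x y] are coordinates with origin [x] on the axes
    directed by [y - x] and by its quarter turn.  They are not normalized, so
    every length gets multiplied by the length of [y - x] (see [along_across]);
    this avoids square roots, and [y] has coordinates [(dist2 x y, 0)]. *)
Definition along x y z : R :=
  (z 0 0 - x 0 0) * (y 0 0 - x 0 0) + (z 0 1 - x 0 1) * (y 0 1 - x 0 1).

Definition across x y z : R :=
  (y 0 0 - x 0 0) * (z 0 1 - x 0 1) - (y 0 1 - x 0 1) * (z 0 0 - x 0 0).

Lemma along_across x y z w :
  (along x y z - along x y w) ^+ 2 + (across x y z - across x y w) ^+ 2 =
  dist2 x y * dist2 z w.
Proof. rewrite /along /across /dist2; ring. Qed.

Lemma across_eq0 x y z : x <> y -> across x y z = 0 ->
  z = x + (along x y z / dist2 x y) *: (y - x).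
Proof.
move=> /dist2_gt0 d0 N0; apply: row2P; rewrite !mxE.
- apply: (mulIf (lt0r_neq0 d0)).
  rewrite mulrDl mulrAC divfK ?gt_eqF//; move: N0; rewrite /across /along /dist2.
  move=> N0; apply/eqP; rewrite -subr_eq0; apply/eqP.
  rewrite -[RHS](mulr0 (x 0 1 - y 0 1)) -N0; ring.
- apply: (mulIf (lt0r_neq0 d0)).
  rewrite mulrDl mulrAC divfK ?gt_eqF//; move: N0; rewrite /across /along /dist2.
  move=> N0; apply/eqP; rewrite -subr_eq0; apply/eqP.
  rewrite -[RHS](mulr0 (y 0 0 - x 0 0)) -N0; ring.
Qed.

(** A disk with center [c = (cu, cn)] and squared radius [S] meets the axis at a
    point of the segment from [0] to [d], but contains neither endpoint in its
    interior.  A point [v] of the circle strictly across the axis from [c] lies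
    in the open disk with diameter that segment, since the cap beyond a chord
    that does not see the center is smaller than a half disk.  Subtracting the
    equation of the circle from the condition on each endpoint bounds the
    squared distance from [v] to that endpoint by a linear expression in [vu];
    the two bounds weighted by [d - vu] and [vu] add up to the conclusion. *)
Lemma cap_coords (d cu cn vu vn pu S : R) : vn * cn < 0 ->
  (vu - cu) ^+ 2 + (vn - cn) ^+ 2 = S ->
  S <= cu ^+ 2 + cn ^+ 2 -> S <= (d - cu) ^+ 2 + cn ^+ 2 ->
  0 <= pu <= d -> (pu - cu) ^+ 2 + cn ^+ 2 < S ->
  vu ^+ 2 + vn ^+ 2 < vu * d.
Proof.
move=> sep vS xS yS /andP[p0 pd] pS.
have vx : vu ^+ 2 + vn ^+ 2 < 2 * vu * cu by nra.
have vy : (d - vu) ^+ 2 + vn ^+ 2 < 2 * (d - vu) * (d - cu) by nra.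
have vn0 : 0 <= vn ^+ 2 by rewrite sqr_ge0.
(* Of the points with first coordinates [pu] and [0], the former is nearer to [c];
   since [0 <= pu], this excludes [cu <= 0].  Symmetrically [cu < d], and [vx],
   [vy] then exclude that [vu] is outside the interval from [0] to [d]. *)
have cu0 : 0 < cu by rewrite ltNge; apply/negP => cu0; nra.
have cud : cu < d by rewrite ltNge; apply/negP => cu0'; nra.
have vu0 : 0 < vu by rewrite ltNge; apply/negP => vu0; nra.
have vud : vu < d by rewrite ltNge; apply/negP => vu0'; nra.
have d0 : 0 < d by lra.
have hx : (d - vu) * (vu ^+ 2 + vn ^+ 2) < (d - vu) * (2 * vu * cu).
  by rewrite ltr_pM2l// subr_gt0.
have hy : vu * ((d - vu) ^+ 2 + vn ^+ 2) < vu * (2 * (d - vu) * (d - cu)).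
  by rewrite ltr_pM2l.
rewrite -(ltr_pM2l d0); lra.
Qed.

Lemma segment_coords x y p : segment x y p ->
  0 <= along x y p <= dist2 x y /\ across x y p = 0.
Proof.
move=> [t /= + <-]; rewrite in_itv /= => /andP[t0 t1].
have -> : along x y (x + t *: (y - x)) = t * dist2 x y.
  by rewrite /along /dist2 !mxE; ring.
split; last by rewrite /across !mxE; ring.
by rewrite mulr_ge0 ?dist2_ge0//= ler_piMl ?dist2_ge0.
Qed.

Lemma dist2_ends x y z :
  dist2 x y * dist2 z x = along x y z ^+ 2 + across x y z ^+ 2 /\
  dist2 x y * dist2 z y = (dist2 x y - along x y z) ^+ 2 + across x y z ^+ 2.
Proof. by split; rewrite /along /across /dist2; ring. Qed.

(** The line of the chord passes through the center, so it meets the disk in a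
    diameter; its midpoint is [c], and the segment contains it. *)
Lemma center_on_chord_line x y c p S : segment x y p -> dist2 c p < S ->
  S <= dist2 c x -> S <= dist2 c y -> across x y c = 0 -> segment x y c.
Proof.
move=> xyp pS Sx Sy N0; have [/andP[p0 pd] Np] := segment_coords xyp.
have xy : x <> y.
  move=> xy; move: xyp => [t _ pE]; have px : p = x by rewrite -pE -xy subrr scaler0 addr0.
  by move: pS; rewrite px ltNge Sx.
have d0 := dist2_gt0 xy.
have [cx cy] := dist2_ends x y c; have cp := along_across x y c p.
have lx : dist2 x y * dist2 c p < dist2 x y * dist2 c x.
  by rewrite ltr_pM2l//; exact: lt_le_trans Sx.
have ly : dist2 x y * dist2 c p < dist2 x y * dist2 c y.
  by rewrite ltr_pM2l//; exact: lt_le_trans Sy.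
move: lx ly; rewrite -cp cx cy N0 Np => lx ly.
rewrite (across_eq0 xy N0); exists (along x y c / dist2 x y) => //.
rewrite /= in_itv /= ler_pdivlMr// ler_pdivrMr// mul0r mul1r.
by apply/andP; split; rewrite leNgt; apply/negP => h; nra.
Qed.

(** The point [v] lies in the open disk with diameter [x y], that is, the angle
    at [v] is obtuse; by the law of cosines this reads as follows. *)
Lemma obtuse_across_chord x y v c p S : segment x y p -> dist2 c p < S ->
  S <= dist2 c x -> S <= dist2 c y -> dist2 c v = S ->
  across x y v * across x y c < 0 -> dist2 v x + dist2 v y < dist2 x y.
Proof.
move=> xyp pS Sx Sy Sv sep; have [p01 Np] := segment_coords xyp.
have xy : x <> y.
  by move=> xy; move: sep; rewrite /across xy !subrr !mul0r subrr mul0r ltxx.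
have d0 := dist2_gt0 xy.
have [cx cy] := dist2_ends x y c; have [vx vy] := dist2_ends x y v.
have cp := along_across x y p c; have cv := along_across x y v c.
have : along x y v ^+ 2 + across x y v ^+ 2 < along x y v * dist2 x y.
  apply: (cap_coords sep cv _ _ p01); rewrite -?cx -?cy.
  - by rewrite (dist2C v) Sv ler_pM2l.
  - by rewrite (dist2C v) Sv ler_pM2l.
  - move: cp; rewrite Np sub0r sqrrN => ->.
    by rewrite (dist2C p) (dist2C v) Sv ltr_pM2l.
by move=> h; rewrite -(ltr_pM2l d0) mulrDr vx vy; lra.
Qed.

(** Leibniz' relation: 9 times the power of the centroid with respect to the
    circumscribed circle is minus the sum of the squared sides.  The centroid is
    given through its coordinates to avoid fixing an expression for it. *)
Lemma centroid_in_disk c s v1 v2 v3 a :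
  v1 <> v2 -> dist2 c v1 = s -> dist2 c v2 = s -> dist2 c v3 = s ->
  (forall i, 3 * a 0 i = v1 0 i + v2 0 i + v3 0 i) -> dist2 c a < s.
Proof.
move=> /dist2_gt0 v12 h1 h2 h3 ha.
have h13 := dist2_ge0 v1 v3; have h23 := dist2_ge0 v2 v3.
have e : 9 * dist2 c a =
    9 * s - (dist2 v1 v2 + dist2 v1 v3 + dist2 v2 v3).
  have -> : 9 * dist2 c a = (3 * c 0 0 - 3 * a 0 0) ^+ 2 + (3 * c 0 1 - 3 * a 0 1) ^+ 2.
    by rewrite /dist2; ring.
  rewrite !ha (_ : 9 * s = 3 * (s + s + s)); last by ring.
  by rewrite -{1}h1 -{1}h2 -h3 /dist2; ring.
lra.
Qed.

(** The signed distances of the vertices to the line, all scaled by the same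
    factor, sum up to three times that of the centroid.  Were all of them on the side of
    [c], they would all vanish, and the triangle would be flat. *)
Lemma opposite_vertex x y c v1 v2 v3 a :
  x <> y -> ~ collinear [set v | v \in [fset v1; v2; v3]%fset] ->
  (forall i, 3 * a 0 i = v1 0 i + v2 0 i + v3 0 i) ->
  across x y c <> 0 -> across x y a * across x y c <= 0 ->
  exists2 v, v \in [fset v1; v2; v3]%fset & across x y v * across x y c < 0.
Proof.
move=> xy ncol ha /eqP c0 ac; apply: contrapT => nov.
have ge v : v \in [fset v1; v2; v3]%fset -> 0 <= across x y v * across x y c.
  by move=> vA; rewrite leNgt; apply/negP => lt; apply: nov; exists v.
have sum : across x y v1 + across x y v2 + across x y v3 = 3 * across x y a.
  transitivity ((y 0 0 - x 0 0) * (3 * a 0 1 - 3 * x 0 1)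
               - (y 0 1 - x 0 1) * (3 * a 0 0 - 3 * x 0 0)).
    by rewrite !ha /across; ring.
  by rewrite /across; ring.
have g1 : 0 <= across x y v1 * across x y c by rewrite ge// !inE eqxx.
have g2 : 0 <= across x y v2 * across x y c by rewrite ge// !inE eqxx orbT.
have g3 : 0 <= across x y v3 * across x y c by rewrite ge// !inE eqxx orbT.
have sumc : across x y v1 * across x y c + across x y v2 * across x y c +
    across x y v3 * across x y c = 3 * (across x y a * across x y c).
  by rewrite -!mulrDl sum mulrA.
apply: ncol; exists x, (y - x) => v /= vA.
exists (along x y v / dist2 x y); apply: across_eq0 => //.
apply: (mulIf c0); rewrite mul0r.
by move: vA; rewrite !inE => /orP[/orP[]|] /eqP ->; lra.
Qed.

End Coordinates.

(** * Spacing of the samples *)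

Section Spacing.
Variable R : realType.
Implicit Types v x y : 'rV[R]_2.

(** If the minimum is [rho v], the Lipschitz bound gives
    [rho x <= rho v + L * l2dist v x]. *)
Lemma lipschitz_inhibition (L : R) (rho : 'rV[R]_2 -> R) v x : 0 <= L ->
  l2lipschitz L rho -> Num.min (rho v) (rho x) < l2dist v x ->
  rho x < (1 + L) * l2dist v x.
Proof.
move=> L0 lip; have := lip v x; rewrite ler_norml => /andP[lip' _].
have := mulr_ge0 L0 (l2dist_ge0 v x).
by rewrite gt_min => Ld /orP[]; lra.
Qed.

(** The factor [1 + L] lost in comparing [rho v] with [rho x] is the one that
    the spacing condition provides for. *)
Lemma far_from_short_edge (L : R) (rho : 'rV[R]_2 -> R) x y v : 0 <= L ->
  l2lipschitz L rho -> Num.min (rho v) (rho x) < l2dist v x ->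
  l2dist x y < Num.sqrt 2 / (1 + L) * Num.min (rho x) (rho y) ->
  dist2 x y < 2 * dist2 v x.
Proof.
move=> L0 lip inh short.
have L1 : 0 < 1 + L by lra.
have s2 : 0 < Num.sqrt (2 : R) by rewrite sqrtr_gt0.
have : l2dist x y < Num.sqrt 2 * l2dist v x.
  apply: (lt_le_trans short).
  rewrite -mulrA ler_pM2l// ler_pdivrMl//.
  apply: ltW; apply: le_lt_trans (lipschitz_inhibition L0 lip inh).
  by rewrite ge_min lexx.
move=> lt; rewrite -!sqr_l2dist -[2](@sqr_sqrtr R)// -exprMn.
by rewrite ltr_pXn2r// nnegrE ?mulr_ge0 ?l2dist_ge0// ltW.
Qed.
End Spacing.

(** * Circumcenters of the Delaunay triangles *)

Theorem lemma3 (R : realType) (Omega : set 'rV[R]_2)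
    (E : {fset {fset 'rV[R]_2}}) (X : set 'rV[R]_2)
    (rho : 'rV[R]_2 -> R) (L : R) (Rc : 'rV[R]_2 -> 'rV[R]_2 -> R) :
  let r := fun x y : 'rV[R]_2 => Num.min (rho x) (rho y) in
  polygonal_region Omega E ->
  (forall x, 0 < rho x) ->
  l2lipschitz L rho ->
  maximal_poisson_disk_sampling Omega r Rc X ->
  vertices E `<=` X ->
  (forall x y, boundary_consecutive Omega E X x y ->
     l2dist x y < Num.sqrt 2 / (1 + L) * r x y) ->
  forall T : {fset {fset 'rV[R]_2}},
    delaunay_triangulation Omega X T ->
    forall A, A \in T -> forall c, circumcenter A c -> closure Omega c.
Proof.
move=> r poly _ lip mps EX spacing T [tri empty] A AT c [s circ].
apply: contrapT => nOc.
have [A3 ncol] := tri_triangle tri AT.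
have [v1 [v2 [v3 [v12 AE]]]] := fset_card3E A3.
rewrite {}AE in ncol circ AT.
set A' := [fset v1; v2; v3]%fset in ncol circ AT.
have A1 : v1 \in A' by rewrite !inE eqxx.
have A2 : v2 \in A' by rewrite !inE eqxx orbT.
have A3' : v3 \in A' by rewrite !inE eqxx orbT.
have AX v : v \in A' -> X v by move=> vA; rewrite -(tri_vertices tri); exists A'.
have circ2 v : v \in A' -> dist2 c v = s ^+ 2.
  by move=> vA; rewrite -(circ v vA) sqr_l2dist.
have s0 : 0 <= s by rewrite -(circ v1 A1) l2dist_ge0.
have outside x : X x -> s ^+ 2 <= dist2 c x.
  move=> Xx; rewrite leNgt -sqr_l2dist; apply/negP => lt.
  apply: (empty _ _ _ AT circ _ Xx).
  by rewrite -(@ltr_pXn2r _ 2)// nnegrE ?l2dist_ge0.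
(* The centroid [a] divides the median from the midpoint [m] in ratio 1 : 2,
   which exhibits it as an iterated convex combination of the vertices. *)
pose m : 'rV[R]_2 := v1 + 2^-1 *: (v2 - v1); pose a : 'rV[R]_2 := m + 3^-1 *: (v3 - m).
have aE i : 3 * a 0 i = v1 0 i + v2 0 i + v3 0 i.
  by rewrite !mxE; field.
have Oa : closure Omega a.
  rewrite -(tri_carrier tri); exists A' => //.
  by apply: hull_convex; [apply: hull_convex| |]; try exact: sub_hull; lra.
have ca := centroid_in_disk v12 (circ2 _ A1) (circ2 _ A2) (circ2 _ A3') aE.
have ends (x y : 'rV[R]_2) : segment x y x /\ segment x y y.
  by rewrite -hull2E; split; apply: sub_hull; [left|right].
have [p acp Fp] := connected_meets_frontier (@connected_segment R 2 a c)
  (ends a c).1 (ends a c).2 Oa nOc.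
have [t t01 pE] := acp.
(* The case [t = 1] is excluded because then [p = c], which is not in
   [closure Omega]. *)
have {t01}/andP[t0 t1] : 0 <= t < 1.
  move: t01; rewrite /= in_itv /= => /andP[-> t1]; rewrite lt_neqAle t1 andbT /=.
  apply/eqP => t11; apply: nOc; move: Fp => [+ _].
  by rewrite -pE t11 scale1r addrC subrK.
have cp : dist2 c p < s ^+ 2.
  apply: le_lt_trans ca.
  have -> : dist2 c p = (1 - t) ^+ 2 * dist2 c a.
    by rewrite -pE /dist2 !mxE; ring.
  by rewrite ler_piMl ?dist2_ge0//; nra.
move: (Fp); rewrite (pr_frontier poly) => -[e eE ep].
have [u [w eE2]] := fset_card2E (pr_edges poly eE).
have eset : [set` e] = [set u; w].
  by rewrite eE2; apply/seteqP; split=> z /=; rewrite !inE;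
    [move=> /orP[]/eqP; [left|right] | case=> ->; rewrite eqxx ?orbT].
have Xu : X u by apply: EX; exists e => //=; rewrite eE2 !inE eqxx.
have Xw : X w by apply: EX; exists e => //=; rewrite eE2 !inE eqxx orbT.
rewrite eset hull2E in ep.
have [x [y [Xx Xy ux uy [xyp cons]]]] :=
  innermost_segment (pds_finite mps) Xu Xw ep.
have Fe z : segment u w z -> frontier Omega z.
  by rewrite (pr_frontier poly) => uz; exists e => //; rewrite eset hull2E.
have N0 : across x y c <> 0.
  move=> N0; apply: nOc.
  have xyc := center_on_chord_line xyp cp (outside _ Xx) (outside _ Xy) N0.
  by have [] := Fe c (segment_trans ux uy xyc).
have xy : x <> y by move=> xy; apply: N0; rewrite /across xy; ring.
(* [p] is on the line and is a convex combination of [a] and [c] with positive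
   weight on [a]. *)
have opp : across x y a * across x y c <= 0.
  have [_ Np] := segment_coords xyp.
  have : (1 - t) * across x y a + t * across x y c = 0.
    by rewrite -Np -pE /across !mxE; ring.
  move=> ac; rewrite -(@pmulr_rle0 _ (1 - t)) ?subr_gt0// mulrA.
  rewrite (_ : (1 - t) * across x y a = - (t * across x y c)); last by lra.
  by rewrite mulNr oppr_le0 -mulrA -expr2 mulr_ge0// sqr_ge0.
have [v vA vc] := opposite_vertex xy ncol aE N0 opp.
have obtuse := obtuse_across_chord xyp cp (outside _ Xx) (outside _ Xy)
  (circ2 _ vA) vc.
have vx : v <> x.
  move=> vx; move: vc; rewrite vx (_ : across x y x = 0) ?mul0r ?ltxx//.
  by rewrite /across; ring.
have vy : v <> y.
  move=> vy; move: vc; rewrite vy (_ : across x y y = 0) ?mul0r ?ltxx//.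
  by rewrite /across; ring.
have short : l2dist x y < Num.sqrt 2 / (1 + L) * r x y.
  apply: spacing; split=> //.
  - by split=> //; exact: Fe.
  - by split=> //; exact: Fe.
  - by exists e; rewrite // eset hull2E.
  - by rewrite hull2E.
(* The Lipschitz bound at two distinct points forces [L] to be nonnegative. *)
have L0 : 0 <= L.
  have : 0 <= L * l2dist x y by apply: le_trans (lip x y).
  by rewrite pmulr_lge0// l2distE sqrtr_gt0 dist2_gt0.
have short' : l2dist y x < Num.sqrt 2 / (1 + L) * Num.min (rho y) (rho x).
  by rewrite minC l2distE dist2C -l2distE.
have Xv := AX _ vA.
have farx := far_from_short_edge L0 lip (pds_empty_disk mps Xv Xx vx) short.
have fary := far_from_short_edge L0 lip (pds_empty_disk mps Xv Xy vy) short'.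
by move: obtuse farx fary; rewrite (dist2C y x); clear; lra.
Qed.
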